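(* Let $(X,\mathcal{A},\mu)$ be a measure space. For an ideal $I$ (not necessarily proper) in $\mathcal{M}(X,\mathcal{A})$, the following statements are equivalent: (1) $\mathcal{M}(X,\mathcal{A})$ equipped with the $U_\mu^I$-topology is a (real) topological vector space. (2) $\mathcal{M}(X,\mathcal{A})$ equipped with the $m_\mu^I$-topology is a (real) topological vector space. (3) $I=\mathcal{M}(X,\mathcal{A})$ and $\mathcal{M}(X,\mathcal{A})=L^\infty(X,\mathcal{A},\mu)$.
   Context: $X$ is a non-empty set, $\mathcal{A}$ a $\sigma$-algebra on $X$, $\mu:\mathcal{A}\to[0,\infty]$ a measure. $\mathcal{M}(X,\mathcal{A})$ is the commutative ring (and real vector space) of all measurable functions $X\to\mathbb{R}$ under pointwise operations. A $\mu$-null set is a set $E\in\mathcal{A}$ with $\mu(E)=0$. A positive unit of $\mathcal{M}(X,\mathcal{A})$ is a $u\in\mathcal{M}(X,\mathcal{A})$ with $u(x)>0$ for all $x\in X$. For an ideal $I$ of $\mathcal{M}(X,\mathcal{A})$, $f\in\mathcal{M}(X,\mathcal{A})$, real $\epsilon>0$ and a positive unit $u$, put $U_\mu(f,I,\epsilon)=\{g\in\mathcal{M}(X,\mathcal{A}): g-f\in I$ and $\sup_{x\in X\setminus E}|f(x)-g(x)|<\epsilon$ for some $\mu$-null set $E\}$ (supremum taken in $[0,\infty]$) and $m_\mu(f,I,u)=\{g\in\mathcal{M}(X,\mathcal{A}): g-f\in I$ and there is a $\mu$-null set $E$ with $|f(x)-g(x)|<u(x)$ for all $x\in X\setminus E\}$.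 The sets $U_\mu(f,I,\epsilon)$ form an open base of the $U_\mu^I$-topology on $\mathcal{M}(X,\mathcal{A})$, and the sets $m_\mu(f,I,u)$ form an open base of the $m_\mu^I$-topology. $L^\infty(X,\mathcal{A},\mu)$ denotes the set of all essentially bounded $f\in\mathcal{M}(X,\mathcal{A})$, i.e. those for which there is a $\mu$-null set $E$ such that $f$ is bounded on $X\setminus E$ (functions are not identified when equal almost everywhere). Topological vector space means that addition and scalar multiplication (with $\mathbb{R}$ carrying its usual topology) are continuous; Hausdorffness is not required. *)

(* Defs.v *)
From HB Require Import structures.
From mathcomp Require Import all_boot all_order all_algebra.
From mathcomp Require Import all_classical all_reals all_analysis.
From mathcomp Require Import measurable_realfun.

Set Implicit Arguments.
Unset Strict Implicit.
Unset Printing Implicit Defensive.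

Import Order.TTheory GRing.Theory Num.Theory.
Import numFieldNormedType.Exports.

Local Open Scope classical_set_scope.
Local Open Scope ring_scope.

(* MathComp's [idealr_closed] only describes proper ideals, whereas the unit
   ideal must be allowed here. *)
Record ideal (A : comNzRingType) := Ideal {
  ideal_set : set A;
  ideal0 : ideal_set 0;
  idealD : forall f g, ideal_set f -> ideal_set g -> ideal_set (f + g);
  idealM : forall a f, ideal_set f -> ideal_set (a * f)
}.

(* Unlike the library's [tvsType], this asks neither for local convexity nor
   for a given uniform structure.  The two conditions are those required of a
   [topologicalLmodType]; continuity of the opposite follows from the second. *)
Definition is_tvs (K : numDomainType) (E : preTopologicalLmodType K) : Prop :=
  continuous (fun z : E * E => z.1 + z.2) /\
  continuous (fun z : K^o * E => z.1 *: z.2).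

Section measurable_functions.
Context d (X : measurableType d) (R : realType).
Implicit Types (f g h u : {mfun X >-> R}) (I : ideal {mfun X >-> R}).

HB.instance Definition _ := isPointed.Build {mfun X >-> R} 0.

Definition positive_unit u : Prop := forall x, 0 < u x.

Variable mu : {measure set X -> \bar R}.

Definition null (E : set X) : Prop := measurable E /\ mu E = 0%E.

(* Functions equal almost everywhere are not identified. *)
Definition Linfty : set {mfun X >-> R} :=
  [set f | exists2 E, null E & [bounded f x | x in ~` E]].

(* The supremum of the empty set is -oo in [\bar R] instead of 0 in [0, +oo];
   this does not affect the comparison with a positive [eps]. *)
Definition Uball I f (eps : R) : set {mfun X >-> R} :=
  [set g | ideal_set I (g - f) /\
    exists2 E, null E &
      (ereal_sup [set `|f x - g x|%:E | x in ~` E] < eps%:E)%E].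

Definition mball I f u : set {mfun X >-> R} :=
  [set g | ideal_set I (g - f) /\
    exists2 E, null E & forall x, ~ E x -> `|f x - g x| < u x].

Lemma null0 : null set0.
Proof. by split; [exact: measurable0|exact: measure0]. Qed.

Lemma nullU E F : null E -> null F -> null (E `|` F).
Proof.
move=> [mE E0] [mF F0]; split; first exact: measurableU.
exact: etrans (measureU0 mE mF F0) E0.
Qed.

Lemma esup_ltP f g (eps : R) (E : set X) : 0 < eps ->
  (ereal_sup [set `|f x - g x|%:E | x in ~` E] < eps%:E)%E <->
  exists2 r, r < eps & forall x, ~ E x -> `|f x - g x| <= r.
Proof.
move=> eps0; split=> [|[r reps fgr]]; last first.
  apply: (@le_lt_trans _ _ r%:E); last by rewrite lte_fin.
  by apply: ge_ereal_sup => _ [x /= nEx <-]; rewrite lee_fin fgr.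
set s := ereal_sup _ => s_eps.
have fg_s x : ~ E x -> (`|f x - g x|%:E <= s)%E.
  by move=> nEx; apply: ereal_sup_ubound; exists x.
case: s s_eps fg_s => [r|//|] seps fgs.
  by exists r => [|x /fgs]; rewrite -?lte_fin// lee_fin.
by exists 0 => // x /fgs; rewrite leeNy_eq.
Qed.

Variable I : ideal {mfun X >-> R}.

Lemma Uball_cover :
  \bigcup_(i in [set i : {mfun X >-> R} * R | 0 < i.2]) Uball I i.1 i.2 = setT.
Proof.
apply/seteqP; split=> // f _; exists (f, 1) => //=; split.
  by rewrite subrr; exact: ideal0.
exists set0; first exact: null0.
by apply/esup_ltP => //; exists 0 => // x _; rewrite subrr normr0.
Qed.

Lemma Uball_join (i j : {mfun X >-> R} * R) h : 0 < i.2 -> 0 < j.2 ->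
  Uball I i.1 i.2 h -> Uball I j.1 j.2 h ->
  exists k : {mfun X >-> R} * R, [/\ 0 < k.2, Uball I k.1 k.2 h &
    Uball I k.1 k.2 `<=` Uball I i.1 i.2 `&` Uball I j.1 j.2].
Proof.
case: i j => [f a] [g b] /= a0 b0.
move=> [Ihf [E nE /esup_ltP-/(_ a0)[r ra fr]]].
move=> [Ihg [F nF /esup_ltP-/(_ b0)[s sb gs]]].
have d0 : 0 < Num.min (a - r) (b - s) by rewrite lt_min !subr_gt0 ra sb.
exists (h, Num.min (a - r) (b - s)); split => //=.
  split; first by rewrite subrr; exact: ideal0.
  exists set0; first exact: null0.
  by apply/esup_ltP => //; exists 0 => // x _; rewrite subrr normr0.
move=> k [Ikh [G nG /esup_ltP-/(_ d0)[t]]].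
rewrite lt_min => /andP[tar tbs] ht; split; split.
- by rewrite -(subrKA h); exact: idealD.
- exists (E `|` G); first exact: nullU.
  apply/esup_ltP => //; exists (r + t); first by rewrite addrC -ltrBrDr.
  move=> x /not_orP[nEx nGx].
  by rewrite (le_trans (ler_distD (h x) _ _))// lerD// ?fr// ht.
- by rewrite -(subrKA h); exact: idealD.
- exists (F `|` G); first exact: nullU.
  apply/esup_ltP => //; exists (s + t); first by rewrite addrC -ltrBrDr.
  move=> x /not_orP[nFx nGx].
  by rewrite (le_trans (ler_distD (h x) _ _))// lerD// ?gs// ht.
Qed.

Lemma mball_refl f u : positive_unit u -> mball I f u f.
Proof.
move=> u0; split; first by rewrite subrr; exact: ideal0.
by exists set0; [exact: null0|move=> x _; rewrite subrr normr0].
Qed.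

Lemma mball_cover :
  \bigcup_(i in [set i : {mfun X >-> R} * {mfun X >-> R} | positive_unit i.2])
    mball I i.1 i.2 = setT.
Proof.
apply/seteqP; split=> // f _; exists (f, 1); first by move=> x; exact: ltr01.
by apply: mball_refl => x; exact: ltr01.
Qed.

Lemma mball_join (i j : {mfun X >-> R} * {mfun X >-> R}) h :
  positive_unit i.2 -> positive_unit j.2 ->
  mball I i.1 i.2 h -> mball I j.1 j.2 h ->
  exists k : {mfun X >-> R} * {mfun X >-> R},
    [/\ positive_unit k.2, mball I k.1 k.2 h &
      mball I k.1 k.2 `<=` mball I i.1 i.2 `&` mball I j.1 j.2].
Proof.
case: i j => [f u] [g v] /= u0 v0 [Ihf [E nE fhu]] [Ihg [F nF ghv]].
pose w x := Num.min (u x - `|f x - h x|) (v x - `|g x - h x|).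
pose w' x := if 0 < w x then w x else 1.
have mw : measurable_fun setT w.
  apply: measurable_minr; apply: measurable_funB => //;
  by apply: measurableT_comp => //; exact: measurable_funB.
have mw' : measurable_fun setT w'.
  by apply: measurable_fun_ifT => //; exact: measurable_fun_ltr.
pose k := mfun_Sub (mem_set mw' : w' \in mfun).
have k0 : positive_unit k by move=> x /=; rewrite /w'; case: ifPn.
exists (h, k); split => //=; first exact: mball_refl.
have kw x : ~ E x -> ~ F x -> k x = w x.
  by move=> nEx nFx; rewrite /= /w' /w lt_min !subr_gt0 fhu// ghv.
move=> l [Ilh [G nG hlk]]; split; split.
- by rewrite -(subrKA h); exact: idealD.
- exists (E `|` F `|` G); first by apply: nullU => //; exact: nullU.
  move=> x /not_orP[/not_orP[nEx nFx] nGx].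
  rewrite (le_lt_trans (ler_distD (h x) _ _))// addrC -ltrBrDr.
  by have := hlk x nGx; rewrite kw// lt_min => /andP[].
- by rewrite -(subrKA h); exact: idealD.
- exists (E `|` F `|` G); first by apply: nullU => //; exact: nullU.
  move=> x /not_orP[/not_orP[nEx nFx] nGx].
  rewrite (le_lt_trans (ler_distD (h x) _ _))// addrC -ltrBrDr.
  by have := hlk x nGx; rewrite kw// lt_min => /andP[].
Qed.

End measurable_functions.

(* Copies of the real vector space of measurable functions, one for each of the
   two topologies. *)
Definition Utop d (X : measurableType d) (R : realType)
  (mu : {measure set X -> \bar R}) (I : ideal {mfun X >-> R}) : Type :=
  {mfun X >-> R}.

Definition mtop d (X : measurableType d) (R : realType)
  (mu : {measure set X -> \bar R}) (I : ideal {mfun X >-> R}) : Type :=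
  {mfun X >-> R}.

Section topologies.
Context d (X : measurableType d) (R : realType).
Variables (mu : {measure set X -> \bar R}) (I : ideal {mfun X >-> R}).

HB.instance Definition _ := GRing.Lmodule.on (Utop mu I).
HB.instance Definition _ := isBaseTopological.Build (Utop mu I)
  (Uball_cover mu I) (@Uball_join _ _ _ mu I).

HB.instance Definition _ := GRing.Lmodule.on (mtop mu I).
HB.instance Definition _ := isBaseTopological.Build (mtop mu I)
  (mball_cover mu I) (@mball_join _ _ _ mu I).

End topologies.

(* Main.v *)
Require Import Defs.
From mathcomp Require Import all_boot all_order all_algebra.
From mathcomp Require Import all_classical all_reals all_analysis.
From mathcomp Require Import measurable_realfun.
From mathcomp Require Import lra.

Import Order.TTheory GRing.Theory Num.Theory.
Import numFieldNormedType.Exports.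

Local Open Scope classical_set_scope.
Local Open Scope ring_scope.

(* In a topological vector space every neighbourhood of 0 absorbs every vector.
   Absorption by [Uball I 0 1] or [mball I 0 1] puts a nonzero multiple of each
   [f] in [I] and bounds it essentially, which gives (3).  Conversely, under (3)
   both topologies are that of the essential supremum seminorm. *)

Section seminormed_tvs.
Set Implicit Arguments.

(** Scalar multiplication is continuous at [(0, x)], where its value is 0, so all small scalars send
    [x] into [U]. A nonzero one is chosen because it will be inverted. *)
Lemma tvs_absorb (R : realType) (E : preTopologicalLmodType R) (x : E)
    (U : set E) :
  is_tvs E -> nbhs (0 : E) U -> exists2 t : R, t != 0 & U (t *: x).
Proof.
move=> [_ scalec]; rewrite -(scale0r x) => /(scalec (0, x)).
move=> [[/= P Q] [/= /nbhs_ballP[e /= e0 eP] /nbhs_singleton Qx] PQU].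
(* Halving [e] gives a nonzero scalar strictly inside the ball of radius [e] around 0. *)
exists (e / 2); first by rewrite gt_eqF ?divr_gt0.
apply: (PQU (e / 2, x)); split => //=; apply: eP.
rewrite /ball /= sub0r normrN gtr0_norm ?divr_gt0//.
lra.
Qed.

(* [N x a] stands for [p x <= a], where [p] is a seminorm. *)
Lemma tvs_seminorm (R : realType) (E : preTopologicalLmodType R)
    (N : E -> R -> Prop) :
  (forall x, exists M, N x M) ->
  (forall x a b, a <= b -> N x a -> N x b) ->
  (forall x y a b, N x a -> N y b -> N (x + y) (a + b)) ->
  (forall t x a, N x a -> N (t *: x) (`|t| * a)) ->
  (forall x (A : set E), nbhs x A <->
     exists2 e, 0 < e & forall y, N (x - y) e -> A y) ->
  is_tvs E.
Proof.
move=> Nfin Nle ND NZ nbhsN.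
have nbhs_ballN x e : 0 < e -> nbhs x [set y | N (x - y) e].
  by move=> e0; apply/nbhsN; exists e.
split=> [[x y] A /nbhsN[e e0 eA]|[a x] A /nbhsN[e e0 eA]].
  exists ([set z | N (x - z) (e / 2)], [set z | N (y - z) (e / 2)]).
    by split; apply: nbhs_ballN; rewrite divr_gt0.
  move=> [x' y'] [/= xx' yy']; apply: eA => /=.
  by rewrite opprD addrACA (splitr e); exact: ND.
(* A bound in [N] may be negative, so it is raised to a nonnegative [M]. *)
have [M0 NxM0] := Nfin x; pose M := Num.max M0 0.
have NxM : N x M by apply: Nle NxM0; rewrite le_max lexx.
have M_ge0 : 0 <= M by rewrite le_max lexx orbT.
(* The radii are chosen so that both terms of [(a - b) *: x + b *: (x - y)] have bound [e / 2]. The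
   cap 1 yields |b| <= |a| + 1; the summand 1 in [M + 1] keeps the denominator positive. *)
have r0 : 0 < Num.min 1 (e / (2 * (M + 1))).
  by rewrite lt_min ltr01 divr_gt0// mulr_gt0// ltr_wpDl.
have a1 : 0 < 2 * (`|a| + 1) by rewrite mulr_gt0// ltr_wpDl.
exists (ball (a : R^o) (Num.min 1 (e / (2 * (M + 1)))),
        [set z | N (x - z) (e / (2 * (`|a| + 1)))]).
  by split; [exact: nbhsx_ballx|apply: nbhs_ballN; exact: divr_gt0].
move=> [b y] [/=]; rewrite /ball /= lt_min => /andP[ab1 abM] xy.
apply: eA => /=.
have -> : a *: x - b *: y = (a - b) *: x + b *: (x - y).
  by rewrite scalerBl scalerBr addrA subrK.
apply: Nle (ND _ _ _ _ (NZ (a - b) _ _ NxM) (NZ b _ _ xy)).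
rewrite [leRHS]splitr lerD//.
  rewrite ltr_pdivlMr ?mulr_gt0 ?ltr_wpDl// in abM.
  have := normr_ge0 (a - b); nra.
rewrite mulrA ler_pdivrMr//.
have : `|b| <= `|a| + 1.
  rewrite -(subKr a b) (le_trans (ler_normB _ _))// lerD2l; exact: ltW.
nra.
Qed.

End seminormed_tvs.

(** * Essential bounds and the neighbourhoods of the two topologies *)

Section measurable_functions.
Set Implicit Arguments.
Context d (X : measurableType d) (R : realType).
Variables (mu : {measure set X -> \bar R}) (I : ideal {mfun X >-> R}).
Implicit Types (f g u : {mfun X >-> R}).

(** The essential supremum seminorm as a relation, meaningful also for [f] without any finite bound;
    it instantiates [N]. *)
Definition ess_bound f (M : R) : Prop :=
  exists2 E, null mu E & forall x, ~ E x -> `|f x| <= M.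

Lemma ess_bound_le f M M' : M <= M' -> ess_bound f M -> ess_bound f M'.
Proof.
by move=> MM' [E nE fM]; exists E => // x /fM /le_trans; apply.
Qed.

Lemma ess_boundD f g M M' :
  ess_bound f M -> ess_bound g M' -> ess_bound (f + g) (M + M').
Proof.
move=> [E nE fM] [F nF gM]; exists (E `|` F); first exact: nullU.
move=> x /not_orP[nEx nFx].
by rewrite (le_trans (ler_normD _ _))// lerD ?fM ?gM.
Qed.

Lemma ess_boundZ (t : R) f M : ess_bound f M -> ess_bound (t *: f) (`|t| * M).
Proof.
by move=> [E nE fM]; exists E => // x /fM; rewrite normrM; exact: ler_wpM2l.
Qed.

Lemma LinftyP f : Linfty mu f <-> exists M, ess_bound f M.
Proof.
split=> [[E nE /ex_strict_bound_gt0[M _ fM]]|[M [E nE fM]]].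
  by exists M, E => // x nEx; exact/ltW/(fM x nEx).
exists E => //=; rewrite /bounded_near; near=> M' => x nEx /=.
apply: le_trans (fM x nEx) _.
by near: M'; apply: nbhs_pinfty_ge; exact: num_real.
Unshelve. all: by end_near. Qed.

(** Open sets are unions of base sets, so one of these contains [f]; its centre may differ from
    [f]. *)
Lemma nbhs_UtopP f (A : set (Utop mu I)) : nbhs (f : Utop mu I) A <->
  exists i : {mfun X >-> R} * R,
    [/\ 0 < i.2, Uball mu I i.1 i.2 f & Uball mu I i.1 i.2 `<=` A].
Proof.
rewrite nbhsE; split=> [[_ [[D D0 <-] [i Di fi]] DA]|[i [i0 fi iA]]].
  exists i; split=> //; first exact: D0.
  by move=> g ig; apply: DA; exists i.
exists (Uball mu I i.1 i.2) => //; split => //.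
by exists [set i]; [move=> _ ->|rewrite bigcup_set1].
Qed.

Lemma nbhs_mtopP f (A : set (mtop mu I)) : nbhs (f : mtop mu I) A <->
  exists i : {mfun X >-> R} * {mfun X >-> R},
    [/\ positive_unit i.2, mball mu I i.1 i.2 f & mball mu I i.1 i.2 `<=` A].
Proof.
rewrite nbhsE; split=> [[_ [[D D0 <-] [i Di fi]] DA]|[i [i0 fi iA]]].
  exists i; split=> //; first exact: D0.
  by move=> g ig; apply: DA; exists i.
exists (mball mu I i.1 i.2) => //; split => //.
by exists [set i]; [move=> _ ->|rewrite bigcup_set1].
Qed.

Lemma Uball_ess_bound f eps g : 0 < eps -> Uball mu I f eps g ->
  ideal_set I (g - f) /\ ess_bound (f - g) eps.
Proof.
move=> eps0 [Ifg [E nE /(esup_ltP _ _ _ eps0)[r re fg]]]; split=> //.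
by exists E => // x /fg /le_trans; apply; exact: ltW.
Qed.

Lemma mball_ess_bound f (eps : R) g : mball mu I f (cst eps) g ->
  ideal_set I (g - f) /\ ess_bound (f - g) eps.
Proof.
move=> [Ifg [E nE fg]]; split=> //.
by exists E => // x /fg /ltW.
Qed.

(** Dividing by [t] recovers [f] from [t *: f], both in the ideal and in the essential bound. *)
Lemma full_of_absorb :
  (forall f, exists2 t : R, t != 0 &
     ideal_set I (t *: f - 0) /\ ess_bound (0 - t *: f) 1) ->
  ideal_set I = setT /\ Linfty mu = setT.
Proof.
move=> H; split; apply/seteqP; split=> // f _; have [t t0 [Itf tf1]] := H f.
  (* An ideal absorbs ring multiplication, so the scalar enters as a constant function. *)
  have -> : f = (cst t^-1 : {mfun X >-> R}) * (t *: f - 0).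
    by rewrite subr0; apply/mfuneqP => x; rewrite [RHS]mulKf.
  exact: idealM.
apply/LinftyP; exists (`|- t^-1| * 1).
have -> : f = - t^-1 *: (0 - t *: f).
  by rewrite sub0r scalerN scaleNr opprK scalerA mulVf ?scale1r.
exact: ess_boundZ.
Qed.

Lemma Utop_tvs_full : is_tvs (Utop mu I : preTopologicalLmodType R) ->
  ideal_set I = setT /\ Linfty mu = setT.
Proof.
move=> Utvs; apply: full_of_absorb => f.
have U0 : nbhs (0 : Utop mu I) (Uball mu I 0 1).
  apply/nbhs_UtopP; exists (0, 1); split=> //; split.
    by rewrite subrr; exact: ideal0.
  exists set0; first exact: null0.
  by apply/esup_ltP => //; exists 0 => // x _; rewrite subrr normr0.
have [t t0 tf] := tvs_absorb (f : Utop mu I) _ Utvs U0.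
by exists t => //; apply: Uball_ess_bound.
Qed.

Lemma mtop_tvs_full : is_tvs (mtop mu I : preTopologicalLmodType R) ->
  ideal_set I = setT /\ Linfty mu = setT.
Proof.
move=> mtvs; apply: full_of_absorb => f.
have u0 : positive_unit (cst 1 : {mfun X >-> R}) by [].
have U0 : nbhs (0 : mtop mu I) (mball mu I 0 (cst 1)).
  apply/nbhs_mtopP; exists (0, cst 1 : {mfun X >-> R}).
  by split=> //; exact: mball_refl.
have [t t0 tf] := tvs_absorb (f : mtop mu I) _ mtvs U0.
by exists t => //; apply: mball_ess_bound.
Qed.

(** * From (3) to topological vector spaces *)

Context (IT : ideal_set I = setT) (LT : Linfty mu = setT).

(** With [I] everything, only the bound matters, and the triangle inequality moves the centre of a
    ball to [f]. *)
Lemma nbhs_Utop_ess f (A : set (Utop mu I)) : nbhs (f : Utop mu I) A <->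
  exists2 e, 0 < e & forall g, ess_bound (f - g) e -> A g.
Proof.
split=> [/nbhs_UtopP[[h eps] /= [eps0 [_ [E nE]]]]|[e e0 eA]].
  move=> /(esup_ltP _ _ _ eps0)[r re hf] hA.
  (* Half of the gap between [r] and [eps] keeps the new supremum strictly below [eps]. *)
  exists ((eps - r) / 2); first by rewrite divr_gt0// subr_gt0.
  move=> g [F nF fg]; apply: hA; split; first by rewrite IT.
  exists (E `|` F); first exact: nullU.
  apply/esup_ltP => //; exists (r + (eps - r) / 2); first lra.
  move=> x /not_orP[nEx nFx].
  by rewrite (le_trans (ler_distD (f x) _ _))// lerD// ?hf ?fg.
apply/nbhs_UtopP; exists (f, e); split=> //=.
  split; first by rewrite IT.
  exists set0; first exact: null0.
  by apply/esup_ltP => //; exists 0 => // x _; rewrite subrr normr0.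
by move=> g /(Uball_ess_bound e0)[_ /eA].
Qed.

(* Where [v > 0], a bound on [ln v] keeps [v] away from [0]: the essential
   boundedness of [ln (u - `|h - f|)] yields the radius. *)
Lemma nbhs_mtop_ess f (A : set (mtop mu I)) : nbhs (f : mtop mu I) A <->
  exists2 e, 0 < e & forall g, ess_bound (f - g) e -> A g.
Proof.
split=> [/nbhs_mtopP[[h u] /= [u0 [_ [E nE hf]] hA]]|[e e0 eA]].
  (* The argument of [ln] is positive off the null set [E], so the values of [ln] at nonpositive
     reals do not matter. *)
  pose w x := ln (u x - `|h x - f x|).
  have mw : measurable_fun setT w.
    apply: measurableT_comp => //; apply: measurable_funB => //.
    by apply: measurableT_comp => //; exact: measurable_funB.
  have : Linfty mu (mfun_Sub (mem_set mw : w \in mfun)) by rewrite LT.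
  move=> /LinftyP[M [F nF wM]].
  (* Off a null set [expR (- M)] is a lower bound of [u - |h - f|]; half of it makes the final
     inequality strict. *)
  exists (expR (- M) / 2); first by rewrite divr_gt0// expR_gt0.
  move=> g [G nG fg]; apply: hA; split; first by rewrite IT.
  exists (E `|` F `|` G); first by apply: nullU => //; exact: nullU.
  move=> x /not_orP[/not_orP[nEx nFx] nGx].
  have w0 : 0 < u x - `|h x - f x| by rewrite subr_gt0 hf.
  have : expR (- M) <= u x - `|h x - f x|.
    rewrite -[leRHS](lnK w0) ler_expR.
    by have /ler_normlP[] := wM x nFx; rewrite lerNl.
  have := ler_distD (f x) (h x) (g x); have := fg x nGx; rewrite /=.
  have := expR_gt0 (- M); lra.
have u0 : positive_unit (cst e : {mfun X >-> R}) by [].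
apply/nbhs_mtopP; exists (f, cst e : {mfun X >-> R}).
split=> //=; first exact: mball_refl.
by move=> g /mball_ess_bound[_ /eA].
Qed.

Lemma Utop_tvs : is_tvs (Utop mu I : preTopologicalLmodType R).
Proof.
apply: (@tvs_seminorm _ (Utop mu I) ess_bound _ _ _ _ nbhs_Utop_ess).
(* Here [LT] makes the seminorm finite on every function. *)
- by move=> f; apply/LinftyP; rewrite LT.
- by move=> f M M'; exact: ess_bound_le.
- exact: ess_boundD.
- exact: ess_boundZ.
Qed.

Lemma mtop_tvs : is_tvs (mtop mu I : preTopologicalLmodType R).
Proof.
apply: (@tvs_seminorm _ (mtop mu I) ess_bound _ _ _ _ nbhs_mtop_ess).
- by move=> f; apply/LinftyP; rewrite LT.
- by move=> f M M'; exact: ess_bound_le.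
- exact: ess_boundD.
- exact: ess_boundZ.
Qed.

End measurable_functions.

Theorem theorem2p6 (d : measure_display) (X : measurableType d) (R : realType)
    (mu : {measure set X -> \bar R}) (I : ideal {mfun X >-> R}) :
  [<-> is_tvs (Utop mu I : preTopologicalLmodType R);
       is_tvs (mtop mu I : preTopologicalLmodType R);
       ideal_set I = setT /\ Linfty mu = setT].
Proof.
(* The cycle of implications goes from (1) to (2) through (3). *)
split=> [/Utop_tvs_full[]|]; first exact: mtop_tvs.
by split=> [/mtop_tvs_full|[]] //; exact: Utop_tvs.
Qed.
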